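(* In the trusted-correlation model, suppose that $\xi\mapsto\chi_{BE}(T_0,\xi)$ is concave and strictly increasing, and that $r^\star<2$, where for a leakage level $\chi_0\in[\chi_{\mathrm{ben}},\chi_{\mathrm{null}}]$ one writes $r^\star=N(T_0,\xi^\star)/N_0$ with $\chi_{BE}(T_0,\xi^\star)=\chi_0$. Then $g_{\mathcal M}$ is convex in $\chi_0$ on $[\chi_{\mathrm{ben}},\chi_{\mathrm{null}}]$.
   Context: Constants: $V_A>0$, $V=V_A+1$, $\eta\in(0,1]$, $v_{\mathrm{el}}\ge0$, $\beta\in(0,1]$. Parameters $(T,\xi)\in\mathcal D=[T_{\min},1]\times[0,\xi_{\max}]$, $T_{\min}>0$; benign point $(T_0,\xi_0)\in\mathcal D$. $N(T,\xi)=1+v_{\mathrm{el}}+\eta T\xi$, $N_0=N(T_0,\xi_0)$, $$\Sigma(T,\xi)=\begin{pmatrix}V_A&\sqrt{\eta T}V_A\\\sqrt{\eta T}V_A&\eta TV_A+N(T,\xi)\end{pmatrix},\qquad \Sigma_0=\Sigma(T_0,\xi_0),$$ $D(\Sigma_0\Vert\Sigma_1)=\tfrac12[\operatorname{tr}(\Sigma_1^{-1}\Sigma_0)-2+\ln(\det\Sigma_1/\det\Sigma_0)]$. $\chi_{BE}(T,\xi)$ is the (continuous) collective-attack reverse-reconciliation Holevo bound: with $\rho_{AB}$ the centered two-mode Gaussian state of covariance $\begin{pmatrix}V\mathbb 1_2&\sqrt{T(V^2-1)}\sigma_z\\\sqrt{T(V^2-1)}\sigma_z&b\mathbb 1_2\end{pmatrix}$,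 $b=T(V_A+\xi)+1$, $\sigma_z=\mathrm{diag}(1,-1)$, purified by $E$, and $y=\sqrt\eta\,q_B+w$ Bob's homodyne outcome ($w$ independent centered Gaussian of variance $1-\eta+v_{\mathrm{el}}$), $\chi_{BE}=S(\rho_E)-\int p(y)S(\rho_{E|y})dy$. $\chi_{\mathrm{ben}}=\chi_{BE}(T_0,\xi_0)$. $I_{AB}(T,\xi)$ is the mutual information of the centered Gaussian pair with covariance $\Sigma(T,\xi)$, and $\chi_{\mathrm{null}}$ is the leakage $\chi_{BE}(T_0,\xi)$ at which the key rate $K=\beta I_{AB}-\chi_{BE}$ vanishes (at $T=T_0$, for some $\xi\in[\xi_0,\xi_{\max}]$). Trusted-correlation model: the monitored set $\mathcal M$ consists of the entries $V_A$ and $\sqrt{\eta T}V_A$ of $\Sigma$, so $T=T_0$ and $$g_{\mathcal M}(\chi_0)=\inf\{D(\Sigma_0\Vert\Sigma(T_0,\xi)):\xi\in[0,\xi_{\max}],\ \chi_{BE}(T_0,\xi)\ge\chi_0\}.$$ *)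

(* Defs.v *)
(* Shot-noise units, i.e. [q, p] = 2i and the vacuum has unit
   quadrature variance; all logarithms are natural, so every entropy and
   information is in nats. *)
From HB Require Import structures.
From mathcomp Require Import all_boot all_order all_algebra.
From mathcomp Require Import complex.
From mathcomp Require Import all_classical all_reals all_analysis.

Set Implicit Arguments.
Unset Strict Implicit.
Unset Printing Implicit Defensive.

Import Order.TTheory GRing.Theory Num.Theory.
Import numFieldNormedType.Exports.

Local Open Scope classical_set_scope.
Local Open Scope ring_scope.

Section quantum.
Variable R : realType.

Local Notation line := (measurableTypeR R).
Local Notation plane := (line * line)%type.
Local Notation leb := (@lebesgue_measure R).
Local Notation leb2 := (leb \x leb)%E.
Local Notation leb4 := (leb2 \x leb \x leb)%E.
Local Notation C := (R[i]).

Definition sqmod (z : C) : R := complex.Re z ^+ 2 + complex.Im z ^+ 2.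

Definition cexpi (x : R) : C := Complex (cos x) (sin x).

Section L2.
Context (d : measure_display) (X : measurableType d)
  (mu : {measure set X -> \bar R}).

Definition cmeasurable (f : X -> C) : Prop :=
  measurable_fun setT (fun x => complex.Re (f x)) /\
  measurable_fun setT (fun x => complex.Im (f x)).

Definition cintegral (f : X -> C) : C :=
  Complex (\int[mu]_x complex.Re (f x))%R (\int[mu]_x complex.Im (f x))%R.

Definition L2norm2 (f : X -> C) : \bar R := (\int[mu]_x (sqmod (f x))%:E)%E.

(* Square-integrable functions are not quotiented by a.e. equality; everything
   below sees them only through integrals. *)
Definition inL2 (f : X -> C) : Prop := cmeasurable f /\ (L2norm2 f < +oo)%E.

Definition cinner (f g : X -> C) : C := cintegral (fun x => conjc (f x) * g x).

Definition orthonormal (u : nat -> X -> C) : Prop :=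
  (forall i, inL2 (u i)) /\
  (forall i j, cinner (u i) (u j) = (i == j)%:R).

(* A positive operator rho on L^2(mu) is represented by its quadratic form
   phi |-> <phi, rho phi>, which determines it. The eigenvalues are listed with
   multiplicity, the list being possibly padded by zeros. *)
Definition spectral_decomposition (rho : (X -> C) -> \bar R)
    (lam : nat -> R) (u : nat -> X -> C) : Prop :=
  [/\ forall i, 0 <= lam i,
      orthonormal u &
      forall phi, inL2 phi ->
        rho phi = (\sum_(0 <= i <oo) (lam i * sqmod (cinner (u i) phi))%:E)%E].

(* S(rho) = - Tr (rho ln rho) = - sum_i lam_i ln lam_i. The eigenvalues, hence
   the sum, do not depend on the decomposition. *)
Definition vN_entropy (rho : (X -> C) -> \bar R) : \bar R :=
  xget 0%E [set s | exists lam u, spectral_decomposition rho lam u /\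
    s = (\sum_(0 <= i <oo) (- (lam i * ln (lam i)))%:E)%E].

End L2.

(* Pure states Psi of the system ABE, in the position representation
   L^2(R^2 x R^2): the first argument is the pair of positions of the modes A
   and B, the second one the positions of the two modes of E. Two modes for E
   are enough to purify every two-mode Gaussian state. *)
Definition wavefun := plane -> plane -> C.

(* Matrix elements of the Weyl operator
     W(s, t) = exp (i (s_A q_A + t_A p_A + s_B q_B + t_B p_B)) (x) 1_E.
   As q is the multiplication by x and p = - 2i d/dx, it acts by
     (W(s, t) Psi)(x, e) = exp (i s.(x + t)) Psi(x + 2 t, e). *)
Definition weylAB (s t : R * R) (Psi : wavefun) : wavefun := fun x e =>
  cexpi (s.1 * (x.1 + t.1) + s.2 * (x.2 + t.2)) *
  Psi (x.1 + 2 * t.1, x.2 + 2 * t.2) e.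

Definition uncurryw (Psi : wavefun) : plane * line * line -> C :=
  fun xe => Psi xe.1.1 (xe.1.2, xe.2).

(* phase-space vector in the ordering (q_A, p_A, q_B, p_B) *)
Definition phase_vec (s t : R * R) : 'rV[R]_(2 + 2) :=
  \row_i nth 0 [:: s.1; t.1; s.2; t.2] i.

(* The reduced state of Psi on AB is the centered Gaussian state of covariance
   gam, i.e. the one of characteristic function
     Tr (rho_AB W(zeta)) = exp (- zeta gam zeta^T / 2).
   At zeta = 0 this says that Psi is a unit vector. *)
Definition purifies_gaussian (gam : 'M[R]_(2 + 2)) (Psi : wavefun) : Prop :=
  inL2 leb4 (uncurryw Psi) /\
  forall s t : R * R,
    cinner leb4 (uncurryw Psi) (uncurryw (weylAB s t Psi)) =
    Complex (expR (- (1 / 2) *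
      (phase_vec s t *m gam *m (phase_vec s t)^T) ord0 ord0)) 0.

(* <phi, rho_E phi>, where rho_E = Tr_AB |Psi><Psi| *)
Definition rhoE (Psi : wavefun) (phi : plane -> C) : \bar R :=
  (\int[leb2]_x (sqmod (cinner leb2 phi (Psi x)))%:E)%E.

Section homodyne.
(* Noisy homodyne detection of B: y = sqrt eta q_B + w, where w is independent,
   centered, Gaussian of variance v >= 0. It is written w = sqrt v z with z
   standard normal, which covers v = 0. Given w, the density of the outcome y
   carries the Jacobian 1 / sqrt eta of q_B = (y - w) / sqrt eta. *)
Variables (eta v : R).

Definition qB_of (y z : R) : R := (y - Num.sqrt v * z) / Num.sqrt eta.

Definition outcome_pdf (Psi : wavefun) (y : R) : \bar R :=
  (\int[normal_prob 0%R 1%R]_z ((Num.sqrt eta)^-1%:E *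
     \int[leb]_a L2norm2 leb2 (Psi (a, qB_of y z))))%E.

(* <phi, rho_(E|y) phi> *)
Definition rhoE_given (Psi : wavefun) (y : R) (phi : plane -> C) : \bar R :=
  ((fine (outcome_pdf Psi y))^-1%:E *
   \int[normal_prob 0%R 1%R]_z ((Num.sqrt eta)^-1%:E *
     \int[leb]_a (sqmod (cinner leb2 phi (Psi (a, qB_of y z))))%:E))%E.

Definition holevo (Psi : wavefun) : R :=
  fine (vN_entropy leb2 (rhoE Psi) -
        \int[leb]_y (outcome_pdf Psi y * vN_entropy leb2 (rhoE_given Psi y)))%E.

End homodyne.

End quantum.

Section model.
Variable R : realType.
Local Notation leb := (@lebesgue_measure R).
Variables (VA eta vel beta : R).

Definition Nvar (T xi : R) : R := 1 + vel + eta * T * xi.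

Definition Sigma (T xi : R) : 'M[R]_2 := \matrix_(i, j)
  if i == 0 then (if j == 0 then VA else Num.sqrt (eta * T) * VA)
  else (if j == 0 then Num.sqrt (eta * T) * VA
        else eta * T * VA + Nvar T xi).

Definition sigma_z : 'M[R]_2 := diag_mx (\row_(i < 2) (-1) ^+ i).

Definition covAB (T xi : R) : 'M[R]_(2 + 2) :=
  let V := VA + 1 in
  let c := Num.sqrt (T * (V ^+ 2 - 1)) in
  let b := T * (VA + xi) + 1 in
  block_mx V%:M (c *: sigma_z) (c *: sigma_z) b%:M.

(* All purifications Psi of rho_AB differ by a unitary on E and yield the same
   value. *)
Definition chiBE (T xi : R) : R :=
  xget 0 [set c | exists Psi : wavefun R,
    purifies_gaussian (covAB T xi) Psi /\
    c = holevo eta (1 - eta + vel) Psi].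

Definition gauss2_pdf (S : 'M[R]_2) (x y : R) : R :=
  let u : 'rV[R]_2 := \row_i nth 0 [:: x; y] i in
  expR (- (1 / 2) * (u *m invmx S *m u^T) ord0 ord0) /
  (2 * pi * Num.sqrt (\det S)).

(* f is the joint density of the pair *)
Definition mutual_info (f : R -> R -> R) : R :=
  (\int[(leb \x leb)%E]_p (f p.1 p.2 *
     ln (f p.1 p.2 / ((\int[leb]_y f p.1 y) * (\int[leb]_x f x p.2)))))%R.

Definition IAB (T xi : R) : R := mutual_info (gauss2_pdf (Sigma T xi)).

Definition keyrate (T xi : R) : R := beta * IAB T xi - chiBE T xi.

Definition KLdiv (S0 S1 : 'M[R]_2) : R :=
  1 / 2 * (\tr (invmx S1 *m S0) - 2 + ln (\det S1 / \det S0)).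

Definition gM (T0 xi0 ximax chi0 : R) : R :=
  inf [set KLdiv (Sigma T0 xi0) (Sigma T0 xi)
      | xi in [set xi | 0 <= xi <= ximax /\ chi0 <= chiBE T0 xi]].

End model.

(* Main.v *)
(* With only xi free, the divergence is h(r) = (1/r - 1 + ln r)/2, where
   r = N(T0, xi)/N0 is affine in xi. As h'(r) = (1/r - 1/r^2)/2, h is
   nondecreasing on [1, +oo[, and convex on [1, 2], where h' increases. A convex
   combination of admissible excess noises for two leakage levels is admissible
   for the same combination of the levels, by concavity of chi, and its
   divergence is bounded by convexity of h. *)
Require Import Defs.
From mathcomp Require Import all_boot all_order all_algebra.
From mathcomp Require Import all_classical all_reals all_analysis.
From mathcomp Require Import ring lra.

Import Order.TTheory GRing.Theory Num.Theory.
Local Open Scope classical_set_scope.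
Local Open Scope ring_scope.

(** Kullback-Leibler divergence of the centered Gaussian of variance 1 from the one of variance
    [r]. *)
Definition gauss_div {R : realType} (r : R) : R := (r^-1 - 1 + ln r) / 2.

Lemma invmx_mulmx1 (F : comUnitRingType) (n : nat) (A B : 'M[F]_n) :
  A *m B = 1%:M -> invmx A = B.
Proof.
by move=> AB1; have [uA _] := mulmx1_unit AB1; rewrite -[B](mulKmx uA) AB1 mulmx1.
Qed.

(** Both matrices have the same first row and column, and the Schur complement of [VA] is the noise
    variance. Only the conditional laws of Bob's outcome given Alice's variable differ, and their
    variances are the two values of [Nvar]. *)
Lemma KLdiv_Sigma {R : realType} (VA eta vel T xi0 xi : R) :
  0 < VA -> 0 <= eta * T -> 0 < Nvar eta vel T xi0 -> 0 < Nvar eta vel T xi ->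
  KLdiv (Sigma VA eta vel T xi0) (Sigma VA eta vel T xi) =
  gauss_div (Nvar eta vel T xi / Nvar eta vel T xi0).
Proof.
move=> VA0 eT; set N0 := Nvar _ _ _ xi0; set N1 := Nvar _ _ _ xi => N0gt N1gt.
set c := eta * T; set s := Num.sqrt c.
have sE : s * s = c by rewrite -expr2 sqr_sqrtr.
have detE x : \det (Sigma VA eta vel T x) = VA * Nvar eta vel T x.
  rewrite (expand_det_row _ ord0) !big_ord_recl big_ord0 /cofactor !det_mx11.
  rewrite !mxE/= -/c -/s; ring: sE.
(* The adjugate divided by the determinant [VA * N1], with [VA] cancelled where possible. *)
pose B : 'M[R]_2 := \matrix_(i, j)
  if i == 0 then (if j == 0 then (c * VA + N1) / (VA * N1) else - s / N1)
  else (if j == 0 then - s / N1 else N1^-1).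
have invE : invmx (Sigma VA eta vel T xi) = B.
  apply: invmx_mulmx1; apply/matrixP => i j.
  rewrite !mxE !big_ord_recl big_ord0 !mxE/= -/c -/s -/N1.
  by case: i => -[|[|//]] ?; case: j => -[|[|//]] ? /=; field: sE; rewrite !gt_eqF.
rewrite /KLdiv invE !detE /gauss_div /mxtrace.
rewrite !big_ord_recl big_ord0 !mxE !big_ord_recl !big_ord0 !mxE/=.
rewrite -/c -/s -/N0 -/N1.
rewrite (_ : VA * N1 / (VA * N0) = N1 / N0); last by field; rewrite !gt_eqF.
by field: sE; rewrite !gt_eqF.
Qed.

Lemma gauss_div_MVT {R : realType} (x y : R) : 0 < x -> x <= y ->
  exists2 c, x <= c <= y &
    gauss_div y - gauss_div x = (c^-1 - (c^-1) ^+ 2) / 2 * (y - x).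
Proof.
move=> x0 xy.
have dh (c : R) : 0 < c ->
    is_derive c 1 (@gauss_div R) ((c^-1 - (c^-1) ^+ 2) / 2).
  move=> c0; have cn0 : c != 0 by rewrite gt_eqF.
  have dV : is_derive c 1 (@GRing.inv R) (- c ^- 2).
    by have := @is_deriveV R id c 1 1 cn0 _; rewrite /GRing.scale/= mulr1; exact.
  have dln := is_derive1_ln c0.
  have -> : @gauss_div R = 2^-1 *: ((@GRing.inv R - cst 1) + @ln R)%R.
    by apply/funext => r; rewrite /gauss_div mulrC.
  apply: is_derive_eq.
  by rewrite /GRing.scale/=; field.
have [||c + ->] := @MVT_segment R (@gauss_div R)
  (fun c => (c^-1 - (c^-1) ^+ 2) / 2) x y xy.
- by move=> z; rewrite in_itv/= => /andP[/(lt_trans x0)]; move/dh.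
- apply: derivable_within_continuous => z.
  rewrite in_itv/= => /andP[/(lt_le_trans x0) z0 _].
  by have [] := dh z z0.
- by rewrite in_itv/= => ?; exists c.
Qed.

(** The mean value theorem gives a slope at some [c] between [x] and [y]. Slopes increase on
    [[1, 2]], so it compares with the slope at [x], in a direction that matches the sign of
    [y - x]. *)
Lemma gauss_div_tangent {R : realType} (x y : R) :
  1 <= x <= 2 -> 1 <= y <= 2 ->
  (x^-1 - (x^-1) ^+ 2) / 2 * (y - x) <= gauss_div y - gauss_div x.
Proof.
move=> /andP[x1 x2] /andP[y1 y2].
have slope_mono (u w : R) : 1 <= u -> u <= w -> w <= 2 ->
    (u^-1 - (u^-1) ^+ 2) / 2 <= (w^-1 - (w^-1) ^+ 2) / 2.
  move=> u1 uw w2.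
  have u0 : 0 < u by lra.
  have w0 : 0 < w by lra.
  rewrite -subr_ge0.
  (* The bound 2 enters here: [u - 1] and [w - 1] lie in [[0, 1]], so their product is at most 1. *)
  rewrite (_ : _ - _ = (w - u) * (1 - (u - 1) * (w - 1)) / ((u * w) ^+ 2 * 2)).
    by rewrite divr_ge0 ?mulr_ge0 ?exprn_ge0//; nra.
  by field; rewrite !gt_eqF.
have [xy|/ltW yx] := leP x y.
  have [||c /andP[xc cy] ->] := gauss_div_MVT x y; [lra|by []|].
  by apply: ler_wpM2r; [rewrite subr_ge0|apply: slope_mono => //; lra].
have [||c /andP[yc cx]] := gauss_div_MVT y x; [lra|by []|].
move=> /(congr1 -%R); rewrite opprB => ->.
rewrite -(opprB x y) mulrN lerN2.
by apply: ler_wpM2r; [rewrite subr_ge0|apply: slope_mono => //; lra].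
Qed.

Lemma gauss_div_ndecr {R : realType} (x y : R) :
  1 <= x -> x <= y -> gauss_div x <= gauss_div y.
Proof.
move=> x1 xy.
have [||c /andP[xc cy] E] := gauss_div_MVT x y; [lra|by []|].
rewrite -subr_ge0 E mulr_ge0 ?subr_ge0// divr_ge0//.
have c1 : 1 <= c by exact: le_trans xc.
by rewrite subr_ge0 expr2 ler_piMr ?invr_ge0 ?invf_le1 //; lra.
Qed.

(** Average the tangent inequalities at the mean point [z]: the first-order terms cancel. *)
Lemma gauss_div_convex {R : realType} (t x y : R) :
  0 <= t <= 1 -> 1 <= x <= 2 -> 1 <= y <= 2 ->
  gauss_div (t * x + (1 - t) * y) <= t * gauss_div x + (1 - t) * gauss_div y.
Proof.
move=> /andP[t0 t1] xI yI; set z := t * x + _.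
have zI : 1 <= z <= 2 by rewrite /z; nra.
have t1_ge0 : 0 <= 1 - t by rewrite subr_ge0.
have := ler_wpM2l t0 (gauss_div_tangent _ _ zI xI).
have := ler_wpM2l t1_ge0 (gauss_div_tangent _ _ zI yI).
set k := _ / 2.
have : t * (k * (x - z)) + (1 - t) * (k * (y - z)) = 0 by rewrite /z; ring.
lra.
Qed.

(* As [chi] is not assumed continuous, a level need not be attained: no
   inverse of [chi] is available. *)
Lemma convex_inf_superlevel {R : realType} (chi d : R -> R) (a b c m : R) :
  a <= b -> b <= c -> c <= m ->
  convex_function (`[a, m] : set R) (fun x => - chi x) ->
  {in `[a, m] &, {homo chi : x y / x < y}} ->
  {in `[b, m] &, {homo d : x y / x <= y}} ->
  convex_function (`[b, c] : set R) d ->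
  convex_function (`[chi b, chi c] : set R)
    (fun l => inf [set d x | x in [set x | a <= x <= m /\ l <= chi x]]).
Proof.
move=> ab bc cm chi_concave chi_incr d_ndecr d_convex.
pose F l := [set d x | x in [set x | a <= x <= m /\ l <= chi x]].
(* Levels above [chi b] are only reached at [x >= b]; replacing [x] by [c] when
   [c < x] keeps it admissible and does not increase [d]. *)
have trunc l y : chi b <= l <= chi c -> F l y ->
    exists x, [/\ b <= x <= c, l <= chi x & d x <= y].
  move=> /andP[bl lc] [x [/andP[ax xm] lx] <-].
  have bx : b <= x.
    rewrite leNgt; apply/negP => xb.
    have : chi x < chi b by apply: chi_incr; rewrite ?in_itv/=; lra.
    by rewrite ltNge (le_trans bl lx).
  have [xc|/ltW cx] := leP x c; first by exists x; rewrite bx.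
  exists c; rewrite bc lexx; split => //.
  by apply: d_ndecr; rewrite ?in_itv/=; lra.
(* [inf] takes a default value on sets that are empty or unbounded below. Here [c] is admissible,
   and [d b] is a lower bound after truncation. *)
have F_inf l : chi b <= l <= chi c -> has_inf (F l).
  move=> lbc; split.
    exists (d c), c => //; split; last by case/andP: lbc.
    by rewrite cm andbT (le_trans ab bc).
  exists (d b) => y /(trunc _ _ lbc)[x [/andP[bx xc] _]].
  by apply: le_trans; apply: d_ndecr; rewrite ?in_itv/=; lra.
move=> t k l; rewrite !inE/= !in_itv/= => kbc lbc.
(* The infima may not be attained, so the argument uses points within [e] of them. The weights sum
   to 1, so the total error is again [e]. *)
rewrite !convRE /unstable.onem -!/(F _); apply/ler_addgt0Pr => e e0.
have [y /(trunc _ _ kbc)[u [ubc ku uy]] ye] := inf_adherent e0 (F_inf _ kbc).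
have [z /(trunc _ _ lbc)[v [vbc lv vz]] ze] := inf_adherent e0 (F_inf _ lbc).
pose w := t%:num * u + (1 - t%:num) * v.
have [t0 t1] : 0 <= t%:num /\ t%:num <= 1 by [].
have t1_ge0 : 0 <= 1 - t%:num by rewrite subr_ge0.
have conv_itv (p q lo hi : R) : lo <= p <= hi -> lo <= q <= hi ->
    lo <= t%:num * p + (1 - t%:num) * q <= hi by nra.
have wbc : b <= w <= c by exact: conv_itv.
have chi_w : t%:num * chi u + (1 - t%:num) * chi v <= chi w.
  have := chi_concave t u v; rewrite !inE/= !in_itv/=.
  move=> /(_ ltac:(lra) ltac:(lra)).
  by rewrite !convRE /unstable.onem !mulrN -opprD lerN2.
have d_w : d w <= t%:num * d u + (1 - t%:num) * d v.
  have := d_convex t u v; rewrite !inE/= !in_itv/=.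
  by move=> /(_ ubc vbc); rewrite !convRE /unstable.onem.
have Fw : F (t%:num * k + (1 - t%:num) * l) (d w).
  exists w => //; split; first lra.
  by apply: le_trans chi_w; rewrite lerD// ler_wpM2l.
apply: (@le_trans _ _ (d w)).
  by apply: ge_inf => //; apply: (F_inf _ _).2; exact: conv_itv.
apply: le_trans d_w _.
have := ler_wpM2l t0 (le_trans uy (ltW ye)).
have := ler_wpM2l t1_ge0 (le_trans vz (ltW ze)).
lra.
Qed.

Theorem theorem3 (R : realType)
  (VA eta vel beta Tmin ximax T0 xi0 xinull : R)
  (hVA : 0 < VA) (heta : 0 < eta <= 1) (hvel : 0 <= vel)
  (hbeta : 0 < beta <= 1) (hTmin : 0 < Tmin)
  (hT0 : Tmin <= T0 <= 1) (hxi0 : 0 <= xi0 <= ximax)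
  (hxinull : xi0 <= xinull <= ximax)
  (hnull : keyrate VA eta vel beta T0 xinull = 0)
  (chi_concave :
    convex_function `[0, ximax] (fun xi : R => - chiBE VA eta vel T0 xi))
  (chi_increasing :
    {in `[0, ximax] &, {homo chiBE VA eta vel T0 : x y / x < y}})
  (hr : forall chi0 xistar : R,
    chiBE VA eta vel T0 xi0 <= chi0 <= chiBE VA eta vel T0 xinull ->
    0 <= xistar <= ximax ->
    chiBE VA eta vel T0 xistar = chi0 ->
    Nvar eta vel T0 xistar / Nvar eta vel T0 xi0 < 2) :
  convex_function
    `[chiBE VA eta vel T0 xi0, chiBE VA eta vel T0 xinull]
    (gM VA eta vel T0 xi0 ximax).
Proof.
have [/andP[eta0 _] /andP[T0min _]] := (heta, hT0).
have /andP[xi0_ge0 _] := hxi0; have /andP[xi0_null null_le] := hxinull.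
have c0 : 0 < eta * T0 by rewrite mulr_gt0// (lt_le_trans hTmin).
have N_gt0 xi : 0 <= xi -> 0 < Nvar eta vel T0 xi.
  by move=> xi_ge0; rewrite /Nvar ltr_wpDr ?(mulr_ge0 (ltW c0))//; lra.
pose r xi := Nvar eta vel T0 xi / Nvar eta vel T0 xi0.
have N0_gt0 := N_gt0 _ xi0_ge0.
have KLE xi : xi0 <= xi ->
    KLdiv (Sigma VA eta vel T0 xi0) (Sigma VA eta vel T0 xi) = gauss_div (r xi).
  move=> le_xi; apply: KLdiv_Sigma => //; first exact: ltW.
  by apply: N_gt0; apply: le_trans le_xi.
have r_le xi xi' : xi <= xi' -> r xi <= r xi'.
  by move=> le_xi; rewrite ler_pM2r ?invr_gt0// /Nvar lerD2l ler_pM2l.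
have r_ge1 xi : xi0 <= xi -> 1 <= r xi.
  by move=> /r_le; rewrite {1}/r divff ?gt_eqF.
(* The hypothesis on the ratio is used at the top leakage level. Since [r] is nondecreasing, this
   bounds it on all of [[xi0, xinull]]. *)
have r_null : r xinull <= 2.
  apply/ltW/(hr _ _ _ _ erefl); last by rewrite null_le (le_trans xi0_ge0).
  rewrite lexx andbT; move: xi0_null; rewrite le_eqVlt => /predU1P[<-|lt_null].
    exact: lexx.
  by apply/ltW/chi_increasing; rewrite ?in_itv/=; lra.
have r_itv xi : xi0 <= xi <= xinull -> 1 <= r xi <= 2.
  by move=> /andP[? ?]; rewrite r_ge1//= (le_trans (r_le _ xinull _)).
(* Monotonicity of the divergence is required up to [ximax], where [r] may exceed 2; convexity only
   up to [xinull]. *)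
apply: convex_inf_superlevel => //.
  move=> xi xi'; rewrite !in_itv/= => /andP[le_xi _] /andP[le_xi' _] xi_xi'.
  by rewrite !KLE//; apply: gauss_div_ndecr; [exact: r_ge1|exact: r_le].
move=> t u v; rewrite !inE/= !in_itv/= => uI vI.
rewrite !convRE /unstable.onem.
have [t0 t1] : 0 <= t%:num /\ t%:num <= 1 by [].
have le_w : xi0 <= t%:num * u + (1 - t%:num) * v by nra.
rewrite !KLE//; [|by case/andP: vI|by case/andP: uI].
(* [r] is affine in the excess noise, so it commutes with convex combinations. *)
have -> : r (t%:num * u + (1 - t%:num) * v) =
    t%:num * r u + (1 - t%:num) * r v by rewrite /r /Nvar; ring.
by apply: gauss_div_convex; rewrite ?t0 ?r_itv.
Qed.
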